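(* Let $r$ and $q$ be positive integers with $r>q\geq 1$. Put $b=r^2+q^2-1$ and $d=r^2-q^2$. Then there exists a Type 1 triangle $T_1(2,b,d)$; that is, $b\geq 3$, $2\leq d\leq b-1$, and there is a Pythagorean triangle with one leg of length $d^2$ and hypotenuse of length $d_{2,b}=d(b+1)$.
   Context: A Pythagorean triangle is a right triangle all of whose side lengths are positive integers. For integers $b\geq 3$, $2\leq d\leq b-1$ and $k\geq 2$, $d_{k,b}=d\,(b^{k-1}+\cdots+b+1)=\dfrac{d(b^k-1)}{b-1}$ denotes the positive integer whose base $b$ representation consists of $k$ digits all equal to $d$. A Pythagorean triangle is a Type 1 triangle with base $b$ repeated digits, denoted $T_1(k,b,d)$ (with $b\geq 3$, $2\leq d\leq b-1$, $k\geq 2$), if one of its two legs has length $d^k$ and its hypotenuse has length $d_{k,b}$. *)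

(* Defs.v *)
From mathcomp Require Import all_boot.

Set Implicit Arguments.
Unset Strict Implicit.
Unset Printing Implicit Defensive.

(* A Pythagorean triangle, given by its side lengths: legs x and y,
   hypotenuse z. *)
Definition pythagorean_triangle (x y z : nat) : Prop :=
  [/\ 0 < x, 0 < y, 0 < z & x ^ 2 + y ^ 2 = z ^ 2].

(* d_{k,b} = d * (b^(k-1) + ... + b + 1) *)
Definition repdigit (k b d : nat) : nat := d * \sum_(i < k) b ^ i.

(* The triangle with legs x, y and hypotenuse z is a T_1(k, b, d). *)
Definition type1_triangle (k b d x y z : nat) : Prop :=
  [/\ 3 <= b, 2 <= d <= b - 1 & 2 <= k] /\
  [/\ pythagorean_triangle x y z,
      x = d ^ k \/ y = d ^ k
    & z = repdigit k b d].

(* Main.v *)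
Require Import Defs.
From mathcomp Require Import all_boot.
From mathcomp Require Import zify.

(** Since [b + 1 = r ^ 2 + q ^ 2], the hypotenuse is
    [(r ^ 2 - q ^ 2) * (r ^ 2 + q ^ 2)]; the triangle is therefore the one
    with sides [r ^ 2 - q ^ 2], [2 * r * q], [r ^ 2 + q ^ 2] scaled by its own
    leg [d = r ^ 2 - q ^ 2]. *)

(* The subtractions below never truncate, since 1 <= q < r. *)
Theorem mainTheorem8 (r q b d : nat) (hq : 1 <= q) (hqr : q < r)
    (hb : b = r ^ 2 + q ^ 2 - 1) (hd : d = r ^ 2 - q ^ 2) :
  exists x y z : nat, type1_triangle 2 b d x y z.
Proof.
have ltq2r2 : q ^ 2 < r ^ 2 by rewrite ltn_sqr.
have q2_gt0 : 0 < q ^ 2 by rewrite expn_gt0 hq.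
have d_ge2 : 2 <= d by nia.
have euclid : d ^ 2 + (2 * (r * q)) ^ 2 = (r ^ 2 + q ^ 2) ^ 2.
  have -> : r ^ 2 = d + q ^ 2 by lia.
  rewrite !expnMn.
  have -> : r ^ 2 = d + q ^ 2 by lia.
  by nia.
exists (d ^ 2), (d * (2 * (r * q))), (d * (r ^ 2 + q ^ 2)).
split; first by split=> //; lia.
split; [split | by left |].
- by rewrite expn_gt0; lia.
- by rewrite !muln_gt0; lia.
- by rewrite muln_gt0; lia.
- by rewrite (expnMn d (2 * _)) (expnMn d (_ + _)) -euclid mulnDr; congr addn.
- rewrite /repdigit !big_ord_recr big_ord0 /= add0n expn0 expn1.
  by congr muln; lia.
Qed.
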